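(* Let $\rho,\sigma$ be pure $n$-qubit states, and let $\epsilon_1>0$, $\epsilon_2>0$, $\delta>0$. Let $\tilde p_{\mathrm{mix}}$ be a distribution on $\{0,1\}^{2n}$ with $\|p_{\mathrm{mix}}-\tilde p_{\mathrm{mix}}\|_{\mathrm{TV}}<\Delta$. Let $f=\frac12(1+\mathrm{tr}(\rho\sigma))$ and let $f(N_1,N_2)=\frac{1}{N_1}\sum_{i=1}^{N_1}G(\hat\alpha_\rho(x_i),\hat\alpha_\sigma(x_i))$ be the symmetric-protocol estimator. Then $$|f(N_1,N_2)-f|\le 2\epsilon_1+2\sqrt{\epsilon_2}+\frac{F_\rho(\epsilon_2)}{2}+\frac{F_\sigma(\epsilon_2)}{2}+2\Delta$$ with probability at least $1-\delta$, provided that $N_1\ge(2\epsilon_1^2)^{-1}\ln(8/\delta)$ and $N_2\ge(2/\epsilon_2^2)\ln(8N_1/\delta)$.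
   Context: Pauli strings $P_x$, $x\in\{0,1\}^{2n}$, are the $n$-qubit Hermitian Pauli strings; $\alpha_\rho(x)=\mathrm{tr}(\rho P_x)$. The Pauli distribution of a pure state is $p_\rho(x)=\alpha_\rho(x)^2/2^n$, and $p_{\mathrm{mix}}=\frac12(p_\rho+p_\sigma)$. Symmetric protocol: draw $x_1,\dots,x_{N_1}$ i.i.d. from $\tilde p_{\mathrm{mix}}$; for each $i$, measure the observable $P_{x_i}$ $N_2$ times on fresh copies of $\rho$ and $N_2$ times on fresh copies of $\sigma$, and let $\hat\alpha_\rho(x_i),\hat\alpha_\sigma(x_i)$ be the empirical means of the $\pm1$ outcomes. $G(u,v)=\frac12\frac{(u+v)^2}{u^2+v^2}$ on $[-1,1]^2\setminus\{(0,0)\}$, with $G(0,0)$ set to an arbitrary fixed value in $[0,1]$. The CDF of a state is $F_\rho(\tau)=\sum_{x:\,\alpha_\rho(x)^2<\tau}p_\rho(x)$. $\|\cdot\|_{\mathrm{TV}}$ is total variation distance. *)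

(* Defs.v *)
From HB Require Import structures.
From mathcomp Require Import all_boot all_order all_algebra.
From mathcomp Require Import reals exp.
From mathcomp Require Import complex.
Set Implicit Arguments. Unset Strict Implicit. Unset Printing Implicit Defensive.
Import Order.TTheory GRing.Theory Num.Theory.
Local Open Scope ring_scope.
Local Open Scope complex_scope.

Section Pauli.
Variable R : realType.
Variable n : nat.

Definition bits := {ffun 'I_n -> bool}.
(* Pauli labels x in {0,1}^{2n}, written as a pair (a,b) of n-bit strings;
   qubit k carries the two bits (a k, b k). *)
Definition pidx := (bits * bits)%type.

(* single-qubit Hermitian Paulis: (0,0)=I, (1,0)=X, (0,1)=Z, (1,1)=Y;
   entry (row s, column t) *)
Definition pauli1 (a b s t : bool) : R[i] :=
  match a, b with
  | false, false => if s == t then 1 else 0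
  | true,  false => if s != t then 1 else 0
  | false, true  => if s == t then (if s then -1 else 1) else 0
  | true,  true  => if s == t then 0 else (if s then 'i else - 'i)
  end.

(* n-qubit Pauli string P_x = tensor product of single-qubit Paulis *)
Definition pauli (x : pidx) (s t : bits) : R[i] :=
  \prod_(k < n) pauli1 (x.1 k) (x.2 k) (s k) (t k).

Definition is_pure_state (psi : bits -> R[i]) : Prop :=
  \sum_(s : bits) psi s * (psi s)^* = 1.
Definition density (psi : bits -> R[i]) (s t : bits) : R[i] :=
  psi s * (psi t)^*.

Definition trace_prod (A B : bits -> bits -> R[i]) : R[i] :=
  \sum_(s : bits) \sum_(t : bits) A s t * B t s.

(* alpha_rho(x) = tr(rho P_x) (a real number; we take the real part) *)
Definition alpha (psi : bits -> R[i]) (x : pidx) : R :=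
  complex.Re (trace_prod (density psi) (pauli x)).

Definition pauli_dist (psi : bits -> R[i]) (x : pidx) : R :=
  alpha psi x ^+ 2 / 2 ^+ n.

Definition p_mix (psi phi : bits -> R[i]) (x : pidx) : R :=
  (pauli_dist psi x + pauli_dist phi x) / 2.

Definition pauli_cdf (psi : bits -> R[i]) (tau : R) : R :=
  \sum_(x : pidx | alpha psi x ^+ 2 < tau) pauli_dist psi x.

Definition fid_target (psi phi : bits -> R[i]) : R :=
  (1 + complex.Re (trace_prod (density psi) (density phi))) / 2.

End Pauli.

Definition is_distribution (T : finType) (R : realType) (p : T -> R) : Prop :=
  (forall x, 0 <= p x) /\ \sum_(x : T) p x = 1.

Definition tv_dist (T : finType) (R : realType) (p q : T -> R) : R :=
  (\sum_(x : T) `|p x - q x|) / 2.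

Definition Gfun (R : realType) (g0 u v : R) : R :=
  if (u == 0) && (v == 0) then g0
  else ((u + v) ^+ 2 / (u ^+ 2 + v ^+ 2)) / 2.

(* probability of a +1 (b = true) / -1 (b = false) outcome when measuring
   a +-1-valued observable whose expectation value is a *)
Definition meas_prob (R : realType) (a : R) (b : bool) : R :=
  if b then (1 + a) / 2 else (1 - a) / 2.

Definition emp_mean (R : realType) (N2 : nat) (bs : {ffun 'I_N2 -> bool}) : R :=
  (\sum_(j < N2) (if bs j then 1 else -1 : R)) / N2%:R.

(* sample space of the symmetric protocol: for each i < N1, the sampled label
   x_i, the N2 outcomes on copies of rho and the N2 outcomes on copies of sigma *)
Definition sample_space (n N1 N2 : nat) : finType :=
  {ffun 'I_N1 -> (pidx n * ({ffun 'I_N2 -> bool} * {ffun 'I_N2 -> bool}))%type}.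

(* the joint probability of an outcome: x_i i.i.d. from pt, and, given x_i,
   independent single-shot measurements of P_{x_i} on fresh copies *)
Definition protocol_prob (R : realType) (n N1 N2 : nat)
  (pt : pidx n -> R) (psi phi : bits n -> R[i]) (w : sample_space n N1 N2) : R :=
  \prod_(i < N1)
     (pt (w i).1 *
      (\prod_(j < N2) meas_prob (alpha psi (w i).1) ((w i).2.1 j)) *
      (\prod_(j < N2) meas_prob (alpha phi (w i).1) ((w i).2.2 j))).

Definition sym_estimator (R : realType) (n N1 N2 : nat) (g0 : R)
  (w : sample_space n N1 N2) : R :=
  (\sum_(i < N1) Gfun g0 (emp_mean R (w i).2.1) (emp_mean R (w i).2.2)) / N1%:R.

(* Main.v *)
Require Import Defs.
From HB Require Import structures.
From mathcomp Require Import all_boot all_order all_algebra.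
From mathcomp Require Import reals exp.
From mathcomp Require Import complex.
From mathcomp Require Import classical_sets topology normedtype derive sequences.
From mathcomp Require Import ring lra.
Set Implicit Arguments. Unset Strict Implicit. Unset Printing Implicit Defensive.
Import Order.TTheory GRing.Theory Num.Theory numFieldNormedType.Exports.
Local Open Scope ring_scope.

(* The single-qubit Paulis satisfy a swap identity, which tensorizes to
   sum_x P_x (x) P_x = 2^n SWAP; hence sum_x alpha_rho(x) alpha_sigma(x) =
   2^n tr(rho sigma), and f is the p_mix-average of G(alpha_rho, alpha_sigma).
   Call x small if both squared expectations are below eps2: the small labels
   have p_mix-mass at most (F_rho(eps2) + F_sigma(eps2)) / 2. At the other
   labels G is stable under perturbations of its arguments, so that, once all
   empirical means are accurate, the estimator lies, up to 2 sqrt eps2, between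
   the empirical means of Z and Y, where Z (resp. Y) equals 0 (resp. 1) at small
   labels and G elsewhere. Both take values in [0, 1], so they concentrate, and
   moving from pt to p_mix costs at most 2 Delta.
   A form of Hoeffding's inequality with a non-optimal constant suffices:
   the slack in the terms 2 eps1 and 2 sqrt eps2 absorbs the loss. *)

(** * Exponential inequalities and the Bernoulli moment generating function *)

Lemma ge0_of_derive_ge0 (R : realType) (f df : R -> R) (x : R) :
  (forall y : R, is_derive y 1 f (df y)) -> f 0 = 0 ->
  (forall y, 0 <= y -> 0 <= df y) -> 0 <= x -> 0 <= f x.
Proof.
move=> dfE f0 df0 x0.
have cf : {within `[0, x], continuous f}%classic.
  apply: continuous_subspaceT => y; apply: differentiable_continuous.
  by apply/derivable1_diffP; apply: ex_derive; exact: dfE.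
have [c cx] := MVT_segment x0 (fun y _ => dfE y) cf.
rewrite f0 !subr0 => ->; rewrite mulr_ge0// df0//.
by move: cx; rewrite in_itv/= => /andP[].
Qed.

(** By symmetry take x >= 0. Then 2 - 2 cosh x * exp (- x^2 / 2) vanishes at 0, and its derivative
    has the sign of x cosh x - sinh x, which is nonnegative by the same derivative argument. *)
Lemma cosh_le_gauss (R : realType) (x : R) :
  expR x + expR (- x) <= 2 * expR (x ^+ 2 / 2).
Proof.
wlog x0 : x / 0 <= x => [hw|].
  have [/hw //|/ltW x0] := leP 0 x.
  by rewrite addrC -sqrrN -{2}[x]opprK hw// oppr_ge0.
have sinh_ge0 (y : R) : 0 <= y -> 0 <= expR y - expR (- y).
  by move=> y0; rewrite subr_ge0 ler_expR; lra.
have tanh_le (y : R) : 0 <= y ->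
    0 <= y * (expR y + expR (- y)) - (expR y - expR (- y)).
  move=> y0.
  pose k (z : R) := z * (expR z + expR (- z)) - (expR z - expR (- z)).
  apply: (@ge0_of_derive_ge0 _ k (fun z => z * (expR z - expR (- z)))) => //.
  - move=> z; apply: is_derive_eq; rewrite /GRing.scale/=; ring.
  - by rewrite /k mul0r oppr0 !subrr.
  - by move=> z z0; rewrite mulr_ge0// sinh_ge0.
pose h (z : R) := 2 - (expR z + expR (- z)) * expR (- (z ^+ 2 / 2)).
have : 0 <= h x.
  apply: (@ge0_of_derive_ge0 _ h (fun z =>
    (z * (expR z + expR (- z)) - (expR z - expR (- z)))
    * expR (- (z ^+ 2 / 2)))) => //.
  - move=> z; apply: is_derive_eq; rewrite /GRing.scale/=; field => //.
  - by rewrite /h expr0n/= mul0r oppr0 expR0; ring.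
  - by move=> z z0; rewrite mulr_ge0// ?expR_ge0// tanh_le.
by rewrite /h subr_ge0 (expRN (x ^+ 2 / 2)) ler_pdivrMr ?expR_gt0.
Qed.

Section hoeffding.
Context {R : realType}.

(** Convexity of the exponential: the tangent at [s * x] lies below the graph at 0 ([A]) and at [s]
    ([B]), and averaging with weights [1 - x] and [x] cancels the slope. *)
Lemma expR_chord (s x : R) : 0 <= x <= 1 -> expR (s * x) <= 1 - x + x * expR s.
Proof.
move=> /andP[x0 x1].
have E0 := expR_gt0 (s * x).
have A : expR (s * x) * (1 - s * x) <= 1.
  rewrite -[leRHS](expRxMexpNx_1 (s * x)) ler_pM2l//.
  exact: expR_ge1Dx.
have B : expR (s * x) * (1 + (s - s * x)) <= expR s.
  rewrite -[in leRHS](subrKC (s * x) s) expRD ler_pM2l//.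
  exact: expR_ge1Dx.
have := ler_wpM2l (_ : 0 <= 1 - x) A.
have := ler_wpM2l x0 B.
rewrite subr_ge0 => h1 /(_ x1) h2; lra.
Qed.

(* Multiplying by the same expression at [- s] symmetrizes the left-hand side
   into [1 + 2 m (1 - m) (cosh s - 1) <= cosh (s / 2) ^ 2]. *)
Lemma bernoulli_mgf (s m : R) : 0 <= m <= 1 ->
  (1 - m + m * expR s) * expR (- (s * m)) <= expR (s ^+ 2 / 4).
Proof.
move=> m01; case/andP: (m01) => m0 m1.
have E0 := expR_gt0 (s / 2); have F0 := expR_gt0 (- (s / 2)).
have EF := expRxMexpNx_1 (s / 2).
have EE : expR s = expR (s / 2) ^+ 2 by rewrite expr2 -expRD -splitr.
have FF : expR (- s) = expR (- (s / 2)) ^+ 2.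
  by rewrite expr2 -expRD -opprD -splitr.
have := cosh_le_gauss (s / 2).
have -> : (s / 2) ^+ 2 / 2 = s ^+ 2 / 8 by field.
have -> : expR (s ^+ 2 / 4) = expR (s ^+ 2 / 8) ^+ 2.
  by rewrite -expRM_natl; congr expR; field.
have G0 := expR_gt0 (s ^+ 2 / 8).
have := expR_chord (- s) m01; rewrite mulNr FF EE.
move: (expR (s / 2)) (expR (- (s / 2))) (expR (s ^+ 2 / 8)) E0 F0 EF G0.
move=> E F G E0 F0 EF G0 ch le.
have a0 : 0 <= 1 - m + m * E ^+ 2 by nra.
apply: le_trans (ler_wpM2l a0 ch) _.
apply: (@le_trans _ _ (((E + F) / 2) ^+ 2)); last first.
  by rewrite ler_sqr ?nnegrE; lra.
(* The multiple of [E * F - 1], which is zero, makes this a polynomial identity in independent [E]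
   and [F]. *)
have -> : (1 - m + m * E ^+ 2) * (1 - m + m * F ^+ 2) =
  ((E + F) / 2) ^+ 2 - (1 - 2 * m) ^+ 2 * (E - F) ^+ 2 / 4
  + (E * F - 1) * (m ^+ 2 * (E * F + 1) + 2 * m * (1-m) - 1).
  by field.
rewrite EF subrr mul0r addr0 lerBlDr lerDl.
by rewrite divr_ge0// mulr_ge0 ?sqr_ge0.
Qed.
End hoeffding.

(** * Monotonicity and union bound for finite sums *)

Section finite_sums.
Context {R : realType} {T : finType}.
Implicit Types (F : T -> R) (P Q S : pred T).

Lemma ler_sum_pred F P Q : (forall t, 0 <= F t) -> (forall t, P t -> Q t) ->
  \sum_(t | P t) F t <= \sum_(t | Q t) F t.
Proof.
move=> F0 PQ; rewrite big_mkcond [leRHS]big_mkcond ler_sum// => t _.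
by case: ifP => [/PQ ->//|_]; case: ifP.
Qed.

Lemma ler_sum_predU F P Q S : (forall t, 0 <= F t) ->
  (forall t, P t -> Q t || S t) ->
  \sum_(t | P t) F t <= \sum_(t | Q t) F t + \sum_(t | S t) F t.
Proof.
move=> F0 PQS; rewrite big_mkcond (big_mkcond Q) (big_mkcond S) -big_split.
apply: ler_sum => t _ /=; have Ft := F0 t; move: (PQS t).
by case: (P t) (Q t) (S t) => -[] [] //= h; try lra; have := h isT.
Qed.

End finite_sums.

(** * Product distributions and Hoeffding's inequality *)

Section product_distribution.
Context {R : realType} {T : finType}.
Variables (p : T -> R) (N : nat).
Hypothesis p_distr : is_distribution p.

Lemma prod_distribution :
  is_distribution (fun w : {ffun 'I_N -> T} => \prod_i p (w i)).
Proof.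
case: p_distr => p0 p1; split=> [w|]; first exact: prodr_ge0.
by rewrite -(bigA_distr_bigA (fun=> p)) big1.
Qed.

(** Union bound over the coordinates, each of which has marginal law [p]. *)
Lemma prod_distribution_exists (C : pred T) :
  \sum_(w : {ffun 'I_N -> T} | [exists i, C (w i)]) \prod_i p (w i)
  <= N%:R * \sum_(t | C t) p t.
Proof.
case: p_distr => p0 p1.
have marginal (i : 'I_N) : \sum_(w : {ffun 'I_N -> T} | C (w i)) \prod_j p (w j)
    = \sum_(t | C t) p t.
  (* The event on coordinate [i] is absorbed into the [i]-th factor, so that the sum over [w]
     becomes a product of sums. *)
  pose q j t := if (j == i) ==> C t then p t else 0.
  transitivity (\prod_j \sum_t q j t).
    rewrite bigA_distr_bigA [LHS]big_mkcond; apply: eq_bigr => w _.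
    case: ifPn => [Cwi|Cwi].
      by apply: eq_bigr => j _; rewrite /q; case: eqP => //= ->; rewrite Cwi.
    by rewrite (bigD1 i)//= /q eqxx (negPf Cwi) mul0r.
  rewrite (bigD1 i)//= [X in _ * X]big1 ?mulr1.
    by rewrite [RHS]big_mkcond; apply: eq_bigr => t _; rewrite /q eqxx.
  by move=> j /negPf ji; rewrite -[RHS]p1; apply: eq_bigr => t _; rewrite /q ji.
apply: (@le_trans _ _
  (\sum_(i < N) \sum_(w : {ffun 'I_N -> T} | C (w i)) \prod_j p (w j))).
  under [leRHS]eq_bigr => i _ do rewrite big_mkcond.
  rewrite exchange_big big_mkcond ler_sum// => w _.
  have w0 : 0 <= \prod_j p (w j) by exact: prodr_ge0.
  case: ifP => [/existsP[i Ci]|_].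
    rewrite [leRHS](bigD1 i)//= Ci lerDl sumr_ge0// => j _.
    by case: ifP.
  by rewrite sumr_ge0// => j _; case: ifP.
under eq_bigr => i _ do rewrite marginal.
by rewrite sumr_const card_ord mulr_natl.
Qed.

(** Chernoff's method: on the event the product of the factors [expR (s * (X (w i) - (m + a)))] is
    at least 1. Its expectation factorizes, and [expR_chord] reduces each factor to a Bernoulli
    variable of mean [m]. *)
Lemma hoeffding_upper (X : T -> R) (a : R) :
  (forall t, 0 <= X t <= 1) -> 0 <= a ->
  \sum_(w : {ffun 'I_N -> T}
        | N%:R * (\sum_t p t * X t + a) <= \sum_i X (w i)) \prod_i p (w i)
  <= expR (- (N%:R * a ^+ 2)).
Proof.
case: p_distr => p0 p1 X01 a0; set m := \sum_t _.
have m01 : 0 <= m <= 1.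
  apply/andP; split; first by apply: sumr_ge0 => t _; have := X01 t; have := p0 t; nra.
  by rewrite -p1; apply: ler_sum => t _; have := X01 t; have := p0 t; nra.
(* The minimizer of s^2 / 4 - s a, the exponent that [bernoulli_mgf] leaves; the minimum is -
   a^2. *)
pose s : R := 2 * a.
have mgf : \sum_t p t * expR (s * (X t - (m + a))) <= expR (- a ^+ 2).
  have -> : - a ^+ 2 = s ^+ 2 / 4 + - (s * a) by rewrite /s; field.
  rewrite expRD; apply: le_trans (ler_wpM2r (expR_ge0 _) (bernoulli_mgf s m01)).
  rewrite -mulrA -expRD.
  have -> : - (s * m) + - (s * a) = - (s * (m + a)) by ring.
  under eq_bigr => t _ do rewrite mulrBr expRD mulrA.
  rewrite -mulr_suml ler_wpM2r ?expR_ge0//.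
  have -> : 1 - m + m * expR s = \sum_t p t * (1 - X t + X t * expR s).
    under [RHS]eq_bigr => t _ do rewrite mulrDr mulrBr mulr1 mulrA.
    by rewrite big_split/= sumrB p1 -mulr_suml.
  by apply: ler_sum => t _; rewrite ler_wpM2l// expR_chord.
apply: (@le_trans _ _ (\sum_(w : {ffun 'I_N -> T})
    \prod_i (p (w i) * expR (s * (X (w i) - (m + a)))))).
  rewrite big_mkcond ler_sum// => w _.
  have w0 : 0 <= \prod_j p (w j) by exact: prodr_ge0.
  rewrite big_split/= -expR_sum; case: ifP => [le_sum|_]; last first.
    by rewrite mulr_ge0// expR_ge0.
  rewrite ler_peMr// -mulr_sumr -[leLHS]expR0 ler_expR mulr_ge0 ?mulr_ge0//.
  by rewrite sumrB sumr_const card_ord subr_ge0 -mulr_natl.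
rewrite -(bigA_distr_bigA (fun=> fun t => p t * expR (s * (X t - (m + a))))).
rewrite prodr_const card_ord -mulrN expRM_natl.
rewrite lerXn2r ?nnegrE ?expR_ge0//.
by apply: sumr_ge0 => t _; rewrite mulr_ge0// expR_ge0.
Qed.

End product_distribution.

(** The lower tail of [X] is the upper tail of [1 - X]. *)
Lemma hoeffding (R : realType) (T : finType) (p : T -> R) (N : nat) (X : T -> R)
    (a : R) :
  is_distribution p -> (forall t, 0 <= X t <= 1) -> 0 <= a -> (0 < N)%N ->
  \sum_(w : {ffun 'I_N -> T}
        | a <= `|(\sum_i X (w i)) / N%:R - \sum_t p t * X t|) \prod_i p (w i)
  <= 2 * expR (- (N%:R * a ^+ 2)).
Proof.
move=> p_distr X01 a0 N0; have [p0 p1] := p_distr.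
have NR : (0 : R) < N%:R by rewrite ltr0n.
have X'01 t : 0 <= 1 - X t <= 1 by have := X01 t; lra.
have -> : 2 * expR (- (N%:R * a ^+ 2)) =
  expR (- (N%:R * a ^+ 2)) + expR (- (N%:R * a ^+ 2)) by ring.
apply: le_trans (lerD (hoeffding_upper N p_distr X01 a0)
                      (hoeffding_upper N p_distr X'01 a0)).
apply: ler_sum_predU => [w|w]; first exact: prodr_ge0.
rewrite sumrB sumr_const card_ord.
under [\sum_t p t * (1 - _)]eq_bigr => t _ do rewrite mulrBr mulr1.
rewrite sumrB p1; move: (\sum_i X (w i)) (\sum_t p t * X t) => S m.
have -> : S / N%:R - m = (S - N%:R * m) / N%:R by field; rewrite gt_eqF.
rewrite normrM (gtr0_norm (_ : 0 < N%:R^-1)) ?invr_gt0// ler_pdivlMr//.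
rewrite ler_normr => /orP[h|h]; apply/orP; [left|right]; lra.
Qed.

(** * Pauli strings: swap identity and expectation values *)

Section pauli_strings.
Context {R : realType}.

Lemma pauli1_conj a b s t : (pauli1 R a b s t)^* = pauli1 R a b t s.
Proof.
by move: a b s t => [] [] [] []; rewrite /pauli1/= ?conjC0 ?conjC1 ?rmorphN ?conjC1//;
  apply/eqP; rewrite eq_complex /= ?oppr0 ?opprK ?eqxx.
Qed.

Lemma pauli1_norm a b s t : `|pauli1 R a b s t| = (s (+) t == a)%:R.
Proof.
have normi : `|'i%C : R[i]| = 1 by rewrite normc_def/= expr0n/= expr1n add0r sqrtr1.
by move: a b s t => [] [] [] []; rewrite /pauli1/= ?normrN ?normr0 ?normr1.
Qed.

(** The identity I(x)I + X(x)X + Y(x)Y + Z(x)Z = 2 SWAP, entry by entry. *)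
Lemma pauli1_swap s t u v :
  \sum_(ab : bool * bool) pauli1 R ab.1 ab.2 s t * pauli1 R ab.1 ab.2 u v
  = 2 * ((s == v) && (t == u))%:R.
Proof.
have ii : 'i%C * 'i%C = -1 :> R[i] by rewrite -expr2 sqr_i.
rewrite -(pair_bigA _ (fun a b => pauli1 R a b s t * pauli1 R a b u v)) /=.
rewrite !big_bool /=.
by move: s t u v => [] [] [] []; rewrite /pauli1/= ?mulrN ?mulNr ?ii; ring.
Qed.

Variable n : nat.
Implicit Types (psi phi : bits n -> R[i]) (x : pidx n) (s t u v : bits n).

Lemma pauli_conj x s t : (pauli R x s t)^* = pauli R x t s.
Proof. by rewrite rmorph_prod; apply: eq_bigr => k _; exact: pauli1_conj. Qed.

(** A Pauli string is a permutation matrix up to phases: row [s] has its only nonzero entry, of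
    modulus 1, in column s xor [x.1]. *)
Lemma pauli_norm_row x s : \sum_t `|pauli R x s t| = 1.
Proof.
under eq_bigr => t _.
  rewrite normr_prod; under eq_bigr => k _ do rewrite pauli1_norm.
  over.
rewrite -(bigA_distr_bigA (fun k b => (s k (+) b == x.1 k)%:R)) big1// => k _.
by rewrite big_bool; case: (s k) (x.1 k) => -[]; rewrite /= ?addr0 ?add0r.
Qed.

Lemma pauli_norm_col x t : \sum_s `|pauli R x s t| = 1.
Proof.
rewrite -[RHS](pauli_norm_row x t); apply: eq_bigr => s _.
by rewrite -[in RHS]pauli_conj norm_conjC.
Qed.

Lemma pauli_swap s t u v :
  \sum_x pauli R x s t * pauli R x u v = 2 ^+ n * ((s == v) && (t == u))%:R.
Proof.
pose g (k : 'I_n) (ab : bool * bool) : R[i] :=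
  pauli1 R ab.1 ab.2 (s k) (t k) * pauli1 R ab.1 ab.2 (u k) (v k).
transitivity (\prod_k \sum_ab g k ab).
  rewrite bigA_distr_bigA.
  (* A pair of bit strings is re-read as a string of bit pairs, one per qubit, so that the sum over
     labels factorizes. *)
  rewrite (reindex (fun f : {ffun 'I_n -> bool * bool} =>
    ([ffun k => (f k).1], [ffun k => (f k).2]) : pidx n)).
    apply: eq_bigr => f _; rewrite -big_split; apply: eq_bigr => k _ /=.
    by rewrite !ffunE.
  exists (fun x : pidx n => [ffun k => (x.1 k, x.2 k)]).
    by move=> f _; apply/ffunP => k; rewrite !ffunE -surjective_pairing.
  by move=> [a b] _; congr pair; apply/ffunP => k; rewrite !ffunE.
under eq_bigr => k _ do rewrite /g pauli1_swap.
rewrite big_split/= prodr_const card_ord; congr (_ * _).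
case: andP => [[/eqP <- /eqP <-]|].
  by rewrite big1// => k _; rewrite !eqxx.
move=> nst; apply/eqP; rewrite prodf_seq_eq0; apply/hasP.
have : ~~ [forall k, (s k == v k) && (t k == u k)].
  apply/negP => /forallP h; apply: nst; split; apply/eqP/ffunP => k;
  by case/andP: (h k) => /eqP ? /eqP.
rewrite negb_forall => /existsP[k hk]; exists k; first exact: mem_index_enum.
by rewrite (negPf hk) eqxx.
Qed.

(** Both matrices are Hermitian, so conjugation only exchanges the two summation indices. Taking the
    real part in [alpha] thus loses nothing. *)
Lemma trace_pauli_real psi x :
  (alpha psi x)%:C%C = trace_prod (density psi) (pauli R x).
Proof.
apply: RRe_real; apply/CrealP; rewrite rmorph_sum/=.
under eq_bigr => s _ do rewrite rmorph_sum/=.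
rewrite exchange_big; apply: eq_bigr => s _; apply: eq_bigr => t _ /=.
by rewrite /density !rmorphM/= conjCK pauli_conj [_ * psi s]mulrC.
Qed.

Lemma sum_alphaM psi phi : \sum_x alpha psi x * alpha phi x =
  2 ^+ n * complex.Re (trace_prod (density psi) (density phi)).
Proof.
have E : \sum_x trace_prod (density psi) (pauli R x) *
                trace_prod (density phi) (pauli R x)
         = 2 ^+ n * trace_prod (density psi) (density phi).
  transitivity (\sum_x \sum_s \sum_t \sum_u \sum_v
      density psi s t * density phi u v * (pauli R x t s * pauli R x v u)).
    apply: eq_bigr => x _; rewrite /trace_prod mulr_suml; apply: eq_bigr => s _.
    rewrite mulr_suml; apply: eq_bigr => t _; rewrite mulr_sumr.
    apply: eq_bigr => u _; rewrite mulr_sumr; apply: eq_bigr => v _.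
    by rewrite mulrACA.
  rewrite exchange_big mulr_sumr; apply: eq_bigr => s _.
  rewrite exchange_big mulr_sumr; apply: eq_bigr => t _.
  (* By the swap identity only the terms with [u = t] and [v = s] survive. *)
  rewrite exchange_big (bigD1 t)//= [X in _ + X]big1 ?addr0 => [|u ut].
    rewrite exchange_big (bigD1 s)//= [X in _ + X]big1 ?addr0 => [|v vs].
      by rewrite -mulr_sumr pauli_swap !eqxx mulr1 mulrC.
    by rewrite -mulr_sumr pauli_swap [s == v]eq_sym (negPf vs) andbF !mulr0.
  rewrite exchange_big big1// => v _.
  by rewrite -mulr_sumr pauli_swap [t == u]eq_sym (negPf ut) !mulr0.
transitivity (complex.Re (\sum_x alpha psi x * alpha phi x)%:C%C) => //.
rewrite rmorph_sum/=; under eq_bigr => x _ do rewrite rmorphM/= !trace_pauli_real.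
rewrite E; have -> : (2 ^+ n : R[i]) = (2 ^+ n)%:C%C by rewrite rmorphXn/= rmorph_nat.
by case: (trace_prod _ _) => a b /=; rewrite mul0r subr0.
Qed.

(** This is tr(rho^2) = 1 for a pure state; it makes [pauli_dist] sum to 1. *)
Lemma sum_alpha_sqr psi : is_pure_state psi ->
  \sum_x alpha psi x ^+ 2 = 2 ^+ n.
Proof.
move=> psi1; under eq_bigr => x _ do rewrite expr2.
rewrite sum_alphaM; suff -> : trace_prod (density psi) (density psi) = 1.
  by rewrite mulr1.
rewrite /trace_prod -[RHS]mulr1 -[in RHS]psi1 mulr_suml; apply: eq_bigr => s _.
rewrite mulr_sumr; apply: eq_bigr => t _.
by rewrite /density; ring.
Qed.

(** A Schur test: bound |psi_s| |psi_t| by the mean of the squares, then use that the moduli in each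
    row and column of [pauli R x] sum to 1. The bound makes [meas_prob] a probability. *)
Lemma alpha_bound psi x : is_pure_state psi -> -1 <= alpha psi x <= 1.
Proof.
move=> psi1; rewrite -ler_norml -lecR; apply: le_trans (normc_ge_Re _) _.
have norm1 : \sum_s `|psi s| ^+ 2 = 1.
  by rewrite -[RHS]psi1; apply: eq_bigr => s _; rewrite normCK.
apply: (@le_trans _ _ (\sum_s \sum_t
   (`|psi s| ^+ 2 + `|psi t| ^+ 2) / 2 * `|pauli R x t s|)).
  apply: le_trans (ler_norm_sum _ _ _) _; apply: ler_sum => s _.
  apply: le_trans (ler_norm_sum _ _ _) _; apply: ler_sum => t _.
  rewrite /density !normrM norm_conjC ler_wpM2r// ler_pdivlMr// mulr_natr.
  by rewrite real_leif_mean_square_scaled ?normr_real.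
under eq_bigr => s _ do under eq_bigr => t _ do rewrite mulrDl mulrDl.
under eq_bigr => s _ do rewrite big_split/= -mulr_sumr pauli_norm_col mulr1.
rewrite big_split/= -mulr_suml norm1 exchange_big/=.
under eq_bigr => s _ do rewrite -mulr_sumr pauli_norm_row mulr1.
by rewrite -mulr_suml norm1 -splitr.
Qed.
End pauli_strings.

(** * Range and stability of G *)

Section Gfun_theory.
Context {R : realType}.

Lemma Gfun01 (g0 u v : R) : 0 <= g0 <= 1 -> 0 <= Gfun g0 u v <= 1.
Proof.
move=> g01; rewrite /Gfun; case: ifPn => // uv.
have r0 : 0 < u ^+ 2 + v ^+ 2.
  rewrite lt_def addr_ge0 ?sqr_ge0// andbT paddr_eq0 ?sqr_ge0//.
  by rewrite !sqrf_eq0.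
apply/andP; split; first by rewrite !divr_ge0 ?sqr_ge0// ltW.
rewrite ler_pdivrMr// ler_pdivrMr//; have := sqr_ge0 (u - v); lra.
Qed.

(* [Gfun] is [(1 + sin 2 theta) / 2] in polar coordinates, so it changes by at
   most the sine of the angle between the two arguments, which is at most their
   distance divided by the norm of [(u, v)]. *)
Lemma Gfun_stable (g0 u v a b e : R) : 0 <= g0 <= 1 -> 0 < e -> e <= u ^+ 2 + v ^+ 2 ->
  (a - u) ^+ 2 <= 2 * e ^+ 2 -> (b - v) ^+ 2 <= 2 * e ^+ 2 ->
  `|Gfun g0 a b - Gfun g0 u v| <= 2 * Num.sqrt e.
Proof.
move=> g01 e0 uve au bv.
have s0 := sqrtr_ge0 e; have se := sqr_sqrtr (ltW e0).
have r0 : 0 < u ^+ 2 + v ^+ 2 by exact: lt_le_trans uve.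
have uvN0 : (u == 0) && (v == 0) = false.
  by apply/negbTE/negP => /andP[/eqP u0 /eqP v0]; move: r0; rewrite u0 v0; lra.
(* If [a] and [b] both vanish, G takes the arbitrary value [g0]. But then e <= u^2 + v^2 <= 4 e^2,
   so 2 sqrt e >= 1 and the range of G suffices. *)
have [ab0|abN0] := boolP ((a == 0) && (b == 0)).
  have : `|Gfun g0 a b - Gfun g0 u v| <= 1.
    have := Gfun01 a b g01; have := Gfun01 u v g01.
    by rewrite ler_norml => /andP[? ?] /andP[? ?]; apply/andP; split; lra.
  move=> /le_trans; apply.
  case/andP: ab0 au bv => /eqP -> /eqP ->; rewrite !sub0r !sqrrN => au bv.
  have e4 : 1 <= 4 * e by rewrite -(ler_pM2l e0); lra.
  by rewrite leNgt; apply/negP => h; nra.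
have q0 : 0 < a ^+ 2 + b ^+ 2.
  rewrite lt_def addr_ge0 ?sqr_ge0// andbT paddr_eq0 ?sqr_ge0//.
  by rewrite !sqrf_eq0.
rewrite -[leRHS]gtr0_norm ?mulr_gt0 ?sqrtr_gt0// -ler_sqr ?nnegrE//.
rewrite !real_normK ?num_real// exprMn se /Gfun uvN0 (negPf abN0).
(* This is (sin 2p - sin 2q) / 2 = sin (p - q) cos (p + q), where p and q are the angles of (a, b)
   and (u, v). *)
have -> : (a + b) ^+ 2 / (a ^+ 2 + b ^+ 2) / 2 - (u + v) ^+ 2 / (u ^+ 2 + v ^+ 2) / 2
   = (a * v - b * u) * (u * a - v * b) * -1
      / ((a ^+ 2 + b ^+ 2) * (u ^+ 2 + v ^+ 2)).
  by field; rewrite !gt_eqF.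
rewrite expr_div_n ler_pdivrMr ?exprn_gt0 ?mulr_gt0// mulrN1 sqrrN exprMn.
have cauchy : (u * a - v * b) ^+ 2 <= (a ^+ 2 + b ^+ 2) * (u ^+ 2 + v ^+ 2).
  by have := sqr_ge0 (u * b + v * a); lra.
(* The left-hand side is the squared determinant of (a, b) and (a - u, b - v); Lagrange's identity
   bounds it by the product of the squared lengths. *)
have cross : (a * v - b * u) ^+ 2 <= 4 * e ^+ 2 * (a ^+ 2 + b ^+ 2).
  apply: (@le_trans _ _
    ((a ^+ 2 + b ^+ 2) * ((a - u) ^+ 2 + (b - v) ^+ 2))).
    by have := sqr_ge0 (a * (a - u) + b * (b - v)); lra.
  by rewrite [leRHS]mulrC ler_pM2l//; lra.
apply: le_trans (ler_pM (sqr_ge0 _) (sqr_ge0 _) cross cauchy) _.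
have -> : 2 ^+ 2 * e * ((a ^+ 2 + b ^+ 2) * (u ^+ 2 + v ^+ 2)) ^+ 2 =
  4 * e * (u ^+ 2 + v ^+ 2)
    * ((a ^+ 2 + b ^+ 2) * ((a ^+ 2 + b ^+ 2) * (u ^+ 2 + v ^+ 2))) by ring.
rewrite -[leLHS]mulrA; apply: ler_wpM2r; first by rewrite ltW// !mulr_gt0.
by rewrite expr2 mulrA ler_pM2l// mulr_gt0.
Qed.
End Gfun_theory.

(** * Tail bound for the empirical mean of one observable *)

Section measurement.
Context {R : realType}.
Implicit Types (a c : R) (N : nat).

Lemma meas_prob_distribution a : -1 <= a <= 1 -> is_distribution (meas_prob a).
Proof.
move=> /andP[? ?]; split=> [[]|]; rewrite ?big_bool /meas_prob/=; [lra|lra|].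
by field.
Qed.

(** A +-1 outcome is 2 b - 1 for a bit b, so an error [c] in the mean is an error [c / 2] in the
    frequency of +1. *)
Lemma emp_mean_tail a c N : -1 <= a <= 1 -> 0 <= c -> (0 < N)%N ->
  \sum_(bs : {ffun 'I_N -> bool} | c <= `|emp_mean R bs - a|)
     \prod_j meas_prob a (bs j)
  <= 2 * expR (- (N%:R * (c / 2) ^+ 2)).
Proof.
move=> a1 c0 N0.
have p_distr := meas_prob_distribution a1.
pose X (b : bool) : R := b%:R.
have X01 b : 0 <= X b <= 1 by case: b; rewrite /X /= ?lexx ler01.
have c20 : 0 <= c / 2 by lra.
apply: le_trans (hoeffding p_distr X01 c20 N0).
apply: ler_sum_pred => bs; first by apply: prodr_ge0 => j _; exact: p_distr.1.
have NN : N%:R != 0 :> R by rewrite pnatr_eq0 -lt0n.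
have -> : emp_mean R bs - a =
    2 * ((\sum_i X (bs i)) / N%:R - \sum_b meas_prob a b * X b).
  have -> : \sum_b meas_prob a b * X b = (1 + a) / 2.
    by rewrite big_bool /meas_prob /X /= mulr1 mulr0 addr0.
  have -> : emp_mean R bs = (2 * (\sum_i X (bs i)) - N%:R) / N%:R.
    rewrite /emp_mean mulr_sumr; congr (_ / _).
    rewrite -[X in _ - X%:R]card_ord -sumr_const -sumrB; apply: eq_bigr => j _.
    by rewrite /X; case: (bs j) => /=; ring.
  by field.
by rewrite normrM ger0_norm// => h; lra.
Qed.

End measurement.

(** * The law of a single round of the protocol *)

Section protocol.
Context {R : realType} {n N2 : nat}.
Variables (psi phi : bits n -> R[i]) (pt : pidx n -> R).
Hypotheses (psi1 : is_pure_state psi) (phi1 : is_pure_state phi).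
Hypothesis pt_distr : is_distribution pt.

Definition round := (pidx n * ({ffun 'I_N2 -> bool} * {ffun 'I_N2 -> bool}))%type.

(** One factor of [protocol_prob]: the protocol is a product distribution over rounds, so the
    results on product distributions apply to it. *)
Definition round_prob (t : round) : R :=
  pt t.1 * (\prod_(j < N2) meas_prob (alpha psi t.1) (t.2.1 j)) *
  (\prod_(j < N2) meas_prob (alpha phi t.1) (t.2.2 j)).

Let outcomes_distr (chi : bits n -> R[i]) x : is_pure_state chi ->
  is_distribution (fun bs : {ffun 'I_N2 -> bool} =>
    \prod_j meas_prob (alpha chi x) (bs j)).
Proof.
by move=> chi1; apply: prod_distribution; exact/meas_prob_distribution/alpha_bound.
Qed.

Lemma round_prob_ge0 t : 0 <= round_prob t.
Proof.
rewrite /round_prob !mulr_ge0 ?pt_distr.1//.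
  exact: (outcomes_distr _ psi1).1.
exact: (outcomes_distr _ phi1).1.
Qed.

(** The outcomes on sigma sum out to 1, leaving the joint law of the label and the outcomes on
    rho. *)
Lemma sum_round_prob_rho (g : pidx n -> {ffun 'I_N2 -> bool} -> R) :
  \sum_t round_prob t * g t.1 t.2.1 = \sum_x pt x *
    \sum_(bs : {ffun 'I_N2 -> bool})
       (\prod_j meas_prob (alpha psi x) (bs j)) * g x bs.
Proof.
rewrite -(pair_bigA _ (fun x b => round_prob (x, b) * g x b.1)) /=.
apply: eq_bigr => x _.
rewrite -(pair_bigA _ (fun b1 b2 => round_prob (x, (b1, b2)) * g x b1)) /=.
rewrite mulr_sumr; apply: eq_bigr => b1 _; rewrite -mulr_suml /round_prob /=.
by rewrite -mulr_sumr (outcomes_distr _ phi1).2 mulr1 mulrA.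
Qed.

Lemma sum_round_prob_sigma (g : pidx n -> {ffun 'I_N2 -> bool} -> R) :
  \sum_t round_prob t * g t.1 t.2.2 = \sum_x pt x *
    \sum_(bs : {ffun 'I_N2 -> bool})
       (\prod_j meas_prob (alpha phi x) (bs j)) * g x bs.
Proof.
rewrite -(pair_bigA _ (fun x b => round_prob (x, b) * g x b.2)) /=.
apply: eq_bigr => x _.
rewrite -(pair_bigA _ (fun b1 b2 => round_prob (x, (b1, b2)) * g x b2)) /=.
rewrite exchange_big mulr_sumr; apply: eq_bigr => b2 _.
rewrite -mulr_suml /round_prob /=.
by rewrite -mulr_suml -mulr_sumr (outcomes_distr _ psi1).2 mulr1 mulrA.
Qed.

Lemma sum_round_prob (g : pidx n -> R) :
  \sum_t round_prob t * g t.1 = \sum_x pt x * g x.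
Proof.
rewrite (sum_round_prob_rho (fun x => fun=> g x)); apply: eq_bigr => x _.
by rewrite -mulr_suml (outcomes_distr _ psi1).2 mul1r.
Qed.

Lemma round_prob_distribution : is_distribution round_prob.
Proof.
split; first exact: round_prob_ge0.
have := sum_round_prob (fun=> 1); under eq_bigr => t _ do rewrite mulr1.
by move=> ->; under eq_bigr => x _ do rewrite mulr1; exact: pt_distr.2.
Qed.

(** Union bound over the two states. Given the label, each tail is at most [2 * E] uniformly in the
    label, hence also on average over [pt]. *)
Lemma round_prob_tail (c : R) : 0 <= c -> (0 < N2)%N ->
  \sum_(t | (c <= `|emp_mean R t.2.1 - alpha psi t.1|)
            || (c <= `|emp_mean R t.2.2 - alpha phi t.1|)) round_prob t
  <= 4 * expR (- (N2%:R * (c / 2) ^+ 2)).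
Proof.
move=> c0 N0; set E := expR _.
have tail (chi : bits n -> R[i]) x : is_pure_state chi ->
    \sum_(bs : {ffun 'I_N2 -> bool} | c <= `|emp_mean R bs - alpha chi x|)
     \prod_j meas_prob (alpha chi x) (bs j) <= 2 * E.
  by move=> chi1; apply: emp_mean_tail => //; exact: alpha_bound.
apply: le_trans (ler_sum_predU round_prob_ge0 (fun t h => h)) _.
suff h : \sum_(t | c <= `|emp_mean R t.2.1 - alpha psi t.1|) round_prob t <= 2 * E /\
         \sum_(t | c <= `|emp_mean R t.2.2 - alpha phi t.1|) round_prob t <= 2 * E.
  by lra.
have ptE : 2 * E = \sum_x pt x * (2 * E) by rewrite -mulr_suml pt_distr.2 mul1r.
have mulb (b : bool) (y : R) : (if b then y else 0) = y * b%:R.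
  by case: b; rewrite ?mulr1 ?mulr0.
split; rewrite big_mkcond ptE; under eq_bigr => t _ do rewrite mulb.
- rewrite (sum_round_prob_rho
    (fun x bs => (c <= `|emp_mean R bs - alpha psi x|)%R%:R)).
  apply: ler_sum => x _; rewrite ler_wpM2l ?pt_distr.1//.
  by apply: le_trans (tail _ x psi1); rewrite [leRHS]big_mkcond ler_sum// => b _;
    rewrite mulb.
- rewrite (sum_round_prob_sigma
    (fun x bs => (c <= `|emp_mean R bs - alpha phi x|)%R%:R)).
  apply: ler_sum => x _; rewrite ler_wpM2l ?pt_distr.1//.
  by apply: le_trans (tail _ x phi1); rewrite [leRHS]big_mkcond ler_sum// => b _;
    rewrite mulb.
Qed.

End protocol.

(** * Averages over the mixed Pauli distribution *)

Lemma tv_dist_expectation (R : realType) (T : finType) (p q X : T -> R) :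
  (forall t, 0 <= X t <= 1) ->
  `|\sum_t p t * X t - \sum_t q t * X t| <= 2 * tv_dist p q.
Proof.
move=> X01; rewrite /tv_dist mulrC divfK ?pnatr_eq0// -sumrB.
apply: le_trans (ler_norm_sum _ _ _) _; apply: ler_sum => t _.
have /andP[X0 X1] := X01 t.
by rewrite -mulrBl normrM (ger0_norm X0) ler_piMr.
Qed.

Section pauli_mixture.
Context {R : realType} {n : nat}.
Variables (psi phi : bits n -> R[i]).

Lemma p_mix_ge0 x : 0 <= p_mix psi phi x.
Proof. by rewrite /p_mix /pauli_dist !(divr_ge0, addr_ge0, sqr_ge0, exprn_ge0). Qed.

(** The weight [p_mix] cancels the denominator of G, leaving a multiple of (alpha_rho +
    alpha_sigma)^2 to expand. Where both expectations vanish the weight is 0, so the value [g0]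
    drops out. *)
Lemma sum_p_mix_Gfun (g0 : R) : is_pure_state psi -> is_pure_state phi ->
  \sum_x p_mix psi phi x * Gfun g0 (alpha psi x) (alpha phi x)
  = fid_target psi phi.
Proof.
move=> psi1 phi1.
have n0 : (2 ^+ n : R) != 0 by rewrite expf_neq0// pnatr_eq0.
transitivity (\sum_x (alpha psi x ^+ 2 + alpha phi x ^+ 2
    + 2 * (alpha psi x * alpha phi x)) / (4 * 2 ^+ n)).
  apply: eq_bigr => x _; rewrite /p_mix /pauli_dist /Gfun.
  case: ifPn => [/andP[/eqP -> /eqP ->]|ab]; first by field.
  field; rewrite n0/= paddr_eq0 ?sqr_ge0// !sqrf_eq0 negb_and -negb_and//.
rewrite -mulr_suml !big_split/= -mulr_sumr !sum_alpha_sqr// sum_alphaM /fid_target.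
by field.
Qed.

Lemma sum_p_mix_small (e : R) :
  \sum_(x | (alpha psi x ^+ 2 < e) && (alpha phi x ^+ 2 < e)) p_mix psi phi x
  <= pauli_cdf psi e / 2 + pauli_cdf phi e / 2.
Proof.
have pd0 (chi : bits n -> R[i]) x : 0 <= pauli_dist chi x.
  by rewrite /pauli_dist divr_ge0 ?sqr_ge0 ?exprn_ge0.
rewrite /p_mix -mulr_suml big_split/= mulrDl.
rewrite lerD// ler_pM2r ?invr_gt0//.
  by apply: ler_sum_pred => // x /andP[].
by apply: ler_sum_pred => // x /andP[].
Qed.

End pauli_mixture.

(** * Deterministic error bound for the estimator *)

(** No probability enters here. The bound on the sum of [Y] controls the estimator from above, and
    that on the sum of [1 - Z] from below, so two upper-tail estimates will suffice. *)
Lemma estimator_deviation (R : realType) (n N1 N2 : nat)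
    (psi phi : bits n -> R[i]) (eps1 eps2 Delta g0 : R) (pt : pidx n -> R)
    (small := fun x => (alpha psi x ^+ 2 < eps2) && (alpha phi x ^+ 2 < eps2))
    (Y := fun x => if small x then 1 else Gfun g0 (alpha psi x) (alpha phi x))
    (Z := fun x => if small x then 0 else Gfun g0 (alpha psi x) (alpha phi x))
    (w : sample_space n N1 N2) :
  is_pure_state psi -> is_pure_state phi -> 0 < eps2 -> 0 <= g0 <= 1 ->
  tv_dist (p_mix psi phi) pt < Delta -> (0 < N1)%N ->
  \sum_i Y (w i).1 <= N1%:R * (\sum_x pt x * Y x + 2 * eps1) ->
  \sum_i (1 - Z (w i).1) <= N1%:R * (\sum_x pt x * (1 - Z x) + 2 * eps1) ->
  (forall i, (emp_mean R (w i).2.1 - alpha psi (w i).1) ^+ 2 <= 2 * eps2 ^+ 2 /\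
             (emp_mean R (w i).2.2 - alpha phi (w i).1) ^+ 2 <= 2 * eps2 ^+ 2) ->
  `|sym_estimator g0 w - fid_target psi phi|
           <= 2 * eps1 + 2 * Num.sqrt eps2 + pauli_cdf psi eps2 / 2
              + pauli_cdf phi eps2 / 2 + 2 * Delta.
Proof.
move=> psi1 phi1 e0 g01 tv N0 leY leZ close.
have NR : (0 : R) < N1%:R by rewrite ltr0n.
have G01 u v := Gfun01 u v g01.
have Y01 x : 0 <= Y x <= 1 by rewrite /Y; case: ifP; rewrite ?ler01 ?lexx.
have Z01 x : 0 <= 1 - Z x <= 1.
  have : 0 <= Z x <= 1 by rewrite /Z; case: ifP; rewrite ?ler01 ?lexx.
  by move=> /andP[? ?]; apply/andP; split; lra.
have small_sum := sum_p_mix_small psi phi eps2.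
(* Raising G to 1 at small labels adds at most their [p_mix]-mass to the average, and replacing
   [p_mix] by [pt] adds at most 2 Delta. *)
have EY : \sum_x pt x * Y x <= fid_target psi phi
    + pauli_cdf psi eps2 / 2 + pauli_cdf phi eps2 / 2 + 2 * Delta.
  have : \sum_x p_mix psi phi x * Y x <= fid_target psi phi
      + \sum_(x | small x) p_mix psi phi x.
    rewrite -(sum_p_mix_Gfun g0)// [X in _ + X]big_mkcond -big_split/=.
    apply: ler_sum => x _; have p0 := p_mix_ge0 psi phi x.
    have /andP[G0 G1] := G01 (alpha psi x) (alpha phi x).
    by rewrite /Y; case: ifP => _; nra.
  have := tv_dist_expectation (p_mix psi phi) pt Y01.
  by rewrite ler_norml => /andP[? ?]; lra.
have EZ : \sum_x pt x * (1 - Z x) <= \sum_x p_mix psi phi x - fid_target psi phi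
    + pauli_cdf psi eps2 / 2 + pauli_cdf phi eps2 / 2 + 2 * Delta.
  have : \sum_x p_mix psi phi x * (1 - Z x) <= \sum_x p_mix psi phi x
      - fid_target psi phi + \sum_(x | small x) p_mix psi phi x.
    rewrite -(sum_p_mix_Gfun g0)// -sumrB [X in _ + X]big_mkcond -big_split/=.
    apply: ler_sum => x _; have p0 := p_mix_ge0 psi phi x.
    have /andP[G0 G1] := G01 (alpha psi x) (alpha phi x).
    by rewrite /Z; case: ifP => _; nra.
  have := tv_dist_expectation (p_mix psi phi) pt Z01.
  by rewrite ler_norml => /andP[? ?]; lra.
have p_mix1 : \sum_x p_mix psi phi x = 1.
  rewrite /p_mix /pauli_dist -mulr_suml big_split/= -!mulr_suml !sum_alpha_sqr//.
  by rewrite divff ?expf_neq0 ?pnatr_eq0//; field.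
pose Gh i := Gfun g0 (emp_mean R (w i).2.1) (emp_mean R (w i).2.2).
have stable i : ~~ small (w i).1 ->
    `|Gh i - Gfun g0 (alpha psi (w i).1) (alpha phi (w i).1)| <= 2 * Num.sqrt eps2.
  rewrite /small negb_and -!leNgt => big.
  apply: Gfun_stable (close i).1 (close i).2 => //.
  have := sqr_ge0 (alpha psi (w i).1); have := sqr_ge0 (alpha phi (w i).1).
  by case/orP: big; lra.
have s0 := sqrtr_ge0 eps2.
have sum_cst (y : R) : N1%:R * y = \sum_(i < N1) y.
  by rewrite sumr_const card_ord mulr_natl.
(* Termwise: at a small label [Y] is 1, which bounds any value of G; at the other labels stability
   costs 2 sqrt eps2. *)
have sumY : \sum_i Gh i <= \sum_i Y (w i).1 + N1%:R * (2 * Num.sqrt eps2).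
  rewrite sum_cst -big_split/=.
  apply: ler_sum => i _; rewrite /Y; case: ifPn => [_|/stable].
    by have := G01 (emp_mean R (w i).2.1) (emp_mean R (w i).2.2); rewrite -/(Gh i); lra.
  by rewrite ler_norml => /andP[? ?]; lra.
have sumZ : N1%:R * 1 - \sum_i Gh i <=
    \sum_i (1 - Z (w i).1) + N1%:R * (2 * Num.sqrt eps2).
  rewrite !sum_cst -sumrB -big_split/=.
  apply: ler_sum => i _; rewrite /Z; case: ifPn => [_|/stable].
    by have := G01 (emp_mean R (w i).2.1) (emp_mean R (w i).2.2); rewrite -/(Gh i); lra.
  by rewrite ler_norml => /andP[? ?]; lra.
have -> : sym_estimator g0 w = (\sum_i Gh i) / N1%:R by [].
rewrite ler_norml; apply/andP; split.
  rewrite -lerBlDr opprK ler_pdivlMr//; nra.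
rewrite lerBlDr ler_pdivrMr//; nra.
Qed.

(** * Choice of constants and union bound over the failure events *)

Theorem theorem14 (R : realType) (n N1 N2 : nat)
  (psi phi : bits n -> R[i]) (eps1 eps2 delta Delta g0 : R)
  (pt : pidx n -> R) :
  is_pure_state psi -> is_pure_state phi ->
  0 < eps1 -> 0 < eps2 -> 0 < delta ->
  0 <= g0 <= 1 ->
  is_distribution pt ->
  tv_dist (p_mix psi phi) pt < Delta ->
  ln (8 / delta) / (2 * eps1 ^+ 2) <= N1%:R ->
  (2 / eps2 ^+ 2) * ln (8 * N1%:R / delta) <= N2%:R ->
  1 - delta <=
  \sum_(w : sample_space n N1 N2 |
         `|sym_estimator g0 w - fid_target psi phi|
           <= 2 * eps1 + 2 * Num.sqrt eps2 + pauli_cdf psi eps2 / 2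
              + pauli_cdf phi eps2 / 2 + 2 * Delta)
    protocol_prob pt psi phi w.
Proof.
move=> psi1 phi1 e10 e20 d0 g01 pt_distr tv N1ge N2ge.
have mu_distr := @round_prob_distribution _ _ N2 _ _ _ psi1 phi1 pt_distr.
have [P0 P1] := prod_distribution N1 mu_distr.
(* For [delta >= 1] the claim is trivial. Otherwise both logarithms are positive, which forces [N1]
   and [N2] to be nonzero. *)
have [d1|d1] := leP 1 delta.
  apply: (@le_trans _ _ 0); first by lra.
  by apply: sumr_ge0 => w _; exact: P0.
have N10 : (0 < N1)%N.
  rewrite lt0n; apply/negP => /eqP N10; move: N1ge; rewrite N10 leNgt => /negP; apply.
  rewrite divr_gt0 ?mulr_gt0 ?exprn_gt0// ln_gt0// ltr_pdivlMr//; lra.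
have N1R : (0 : R) < N1%:R by rewrite ltr0n.
have N1R1 : (1 : R) <= N1%:R by rewrite ler1n.
have N20 : (0 < N2)%N.
  rewrite lt0n; apply/negP => /eqP N20; move: N2ge; rewrite N20 leNgt => /negP; apply.
  rewrite mulr_gt0 ?divr_gt0 ?exprn_gt0// ln_gt0// ltr_pdivlMr//; lra.
(* Allowing the deviation 2 eps1 gives the exponent 4 N1 eps1^2, twice what the hypothesis on [N1]
   needs to supply ln (8 / delta). *)
have tail1 : expR (- (N1%:R * (2 * eps1) ^+ 2)) <= delta / 8.
  have d8 : 0 < 8 / delta by rewrite divr_gt0.
  rewrite -[delta / 8]invf_div -[8 / delta]lnK ?posrE// -expRN ler_expR lerN2.
  move: N1ge; rewrite ler_pdivrMr ?mulr_gt0 ?exprn_gt0// => N1ge.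
  apply: le_trans N1ge _; have := mulr_gt0 N1R (exprn_gt0 2 e10); lra.
(* With this accuracy the exponent N2 (c / 2)^2 is N2 eps2^2 / 2, matching the hypothesis on [N2],
   and c^2 = 2 eps2^2 is the tolerance in [Gfun_stable]. *)
pose c := Num.sqrt 2 * eps2.
have c2 : c ^+ 2 = 2 * eps2 ^+ 2 by rewrite exprMn sqr_sqrtr.
have c0 : 0 <= c by rewrite mulr_ge0 ?sqrtr_ge0// ltW.
have tail2 : expR (- (N2%:R * (c / 2) ^+ 2)) <= delta / (8 * N1%:R).
  have d8 : 0 < 8 * N1%:R / delta by rewrite divr_gt0 ?mulr_gt0.
  rewrite -[delta / (8 * N1%:R)]invf_div -[8 * N1%:R / delta]lnK ?posrE//.
  rewrite -expRN ler_expR lerN2 expr_div_n c2.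
  move: N2ge; rewrite mulrAC ler_pdivrMr ?exprn_gt0//; lra.
pose small x := (alpha psi x ^+ 2 < eps2) && (alpha phi x ^+ 2 < eps2).
pose Y x := if small x then 1 else Gfun g0 (alpha psi x) (alpha phi x).
pose Z x := if small x then 0 else Gfun g0 (alpha psi x) (alpha phi x).
have Y01 x : 0 <= Y x <= 1.
  by rewrite /Y; case: ifP => _; [rewrite ler01 lexx|exact: Gfun01].
have Z01 x : 0 <= 1 - Z x <= 1.
  have : 0 <= Z x <= 1.
    by rewrite /Z; case: ifP => _; [rewrite ler01 lexx|exact: Gfun01].
  by move=> /andP[? ?]; apply/andP; split; lra.
have e1 : 0 <= 2 * eps1 by lra.
have tailY := hoeffding_upper N1 mu_distr (fun t => Y01 t.1) e1.
have tailZ := hoeffding_upper N1 mu_distr (fun t => Z01 t.1) e1.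
have tailC := prod_distribution_exists N1 mu_distr
  (fun t => (c <= `|emp_mean R t.2.1 - alpha psi t.1|)
            || (c <= `|emp_mean R t.2.2 - alpha phi t.1|)).
have := round_prob_tail psi1 phi1 pt_distr c0 N20.
move=> /(ler_wpM2l (ltW N1R)) /(le_trans tailC) {}tailC.
move: tailY tailZ; rewrite (sum_round_prob pt psi1 phi1 Y).
rewrite (sum_round_prob pt psi1 phi1 (fun x => 1 - Z x)) => tailY tailZ.
pose F (v : sample_space n N1 N2) := \prod_i round_prob psi phi pt (v i).
set good := BIG_P; change (1 - delta <= \sum_(v | good v) F v).
have total : \sum_(v | good v) F v + \sum_(v | ~~ good v) F v = 1.
  by rewrite -P1 [RHS](bigID good).
suff : \sum_(v | ~~ good v) F v <= delta by lra.
(* Inaccurate empirical means account for delta / 2 of the failure probability; the tails of [Y] and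
   [1 - Z] add delta / 8 each. *)
have fail : N1%:R * (4 * expR (- (N2%:R * (c / 2) ^+ 2))) <= delta / 2.
  have := ler_wpM2l (ltW N1R) (ler_wpM2l (ler0n R 4) tail2).
  by have -> : N1%:R * (4%:R * (delta / (8 * N1%:R))) = delta / 2
    by field; rewrite gt_eqF.
pose QY (v : sample_space n N1 N2) :=
  N1%:R * (\sum_x pt x * Y x + 2 * eps1) <= \sum_i Y (v i).1.
pose QZ (v : sample_space n N1 N2) :=
  N1%:R * (\sum_x pt x * (1 - Z x) + 2 * eps1) <= \sum_i (1 - Z (v i).1).
pose QC (v : sample_space n N1 N2) := [exists i,
  (c <= `|emp_mean R (v i).2.1 - alpha psi (v i).1|)
  || (c <= `|emp_mean R (v i).2.2 - alpha phi (v i).1|)].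
(* By contraposition of [estimator_deviation], a bad outcome lies in one of the three failure
   events. *)
have union1 : \sum_(v | ~~ good v) F v <=
    \sum_(v | QY v || QZ v) F v + \sum_(v | QC v) F v.
  apply: ler_sum_predU => // v; apply: contraR.
  rewrite !negb_or -!ltNge => /andP[/andP[nY nZ] nC].
  apply: estimator_deviation (ltW nY) (ltW nZ) _ => // i.
  move: nC; rewrite negb_exists => /forallP/(_ i).
  rewrite negb_or -!ltNge -c2 => /andP[? ?].
  by split; rewrite -real_normK ?num_real// lerXn2r ?nnegrE ?normr_ge0// ltW.
have union2 := ler_sum_predU P0 (fun v (h : QY v || QZ v) => h).
apply: le_trans union1 _; apply: le_trans (lerD union2 tailC) _.
have := lerD (le_trans tailY tail1) (le_trans tailZ tail1).
move=> /(lerD fail); lra.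
Qed.
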